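(* The short exact sequence $1\to PCV\to CV\xrightarrow{\ \overline\pi\ }V\to1$ does not split; that is, there is no group homomorphism $\iota:V\to CV$ with $\overline\pi\circ\iota=\mathrm{id}_V$.
   Context: Trees. A rooted binary tree is a single vertex or a finite rooted tree in which every non-leaf vertex has a left child and a right child; its $n$ leaves are numbered $1,\dots,n$ from left to right. A caret is the rooted binary tree with two leaves. Attaching a caret to a leaf means identifying the root of the caret with that leaf. Cactus groups. $J_1=\{1\}$; for $n\ge2$, $J_n$ is generated by $s_{i,j}$ $(1\le i<j\le n)$ with relations $s_{i,j}^2=1$; $s_{i,j}s_{k,l}=s_{k,l}s_{i,j}$ for $i<j<k<l$; $s_{i,j}s_{k,l}=s_{i+j-l,i+j-k}s_{i,j}$ for $i\le k<l\le j$. The homomorphism $\pi_n:J_n\to S_n$ sends $s_{i,j}$ to the permutation $m\mapsto i+j-m$ for $i\le m\le j$, fixing all other $m$. Permutations are composed left to right: $(\sigma\tau)(m)=\tau(\sigma(m))$. The cactus Thompson group $CV$. A cactus-tree pair is a triple $(T_+,s,T_-)$ with $T_\pm$ rooted binary trees with the same number $n$ of leaves and $s\in J_n$. For $1\le i\le n$, writing $s=s_{j_1,k_1}\cdots s_{j_l,k_l}$, put $p_1=i$ and let $p_{m+1}$ be the image of $p_m$ under $\pi_n(s_{j_m,k_m})$. Set $s'=s'_1\cdots s'_l\in J_{n+1}$, where $s'_m=s_{j_m,k_m}$ if $k_m<p_m$; $s'_m=s_{p_m,p_m+1}s_{j_m,k_m+1}$ if $j_m\le p_m\le k_m$; $s'_m=s_{j_m+1,k_m+1}$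 if $p_m<j_m$. Attaching a caret to leaf $i$ of $T_+$ and to leaf $\pi_n(s)(i)$ of $T_-$ gives $T'_+,T'_-$; the triple $(T'_+,s',T'_-)$ is called an expansion of $(T_+,s,T_-)$. $CV$ is the set of cactus-tree pairs modulo the equivalence relation generated by expansions. Product: given two classes, choose representatives $(S_+,s,S_-)$, $(T_+,t,T_-)$ with $S_-=T_+$; the product is the class of $(S_+,st,T_-)$. The identity is the class of $(T,1,T)$ and the inverse of $(T_+,s,T_-)$ is $(T_-,s^{-1},T_+)$. Thompson's group $V$ is defined in the same way from tree pairs $(T_+,\sigma,T_-)$ with $\sigma\in S_n$: an expansion attaches a caret to leaf $i$ of $T_+$ and to leaf $\sigma(i)$ of $T_-$ and replaces $\sigma$ by the induced bijection of leaves (left child matched with left child, right child with right child, all other leaves matched as before). The map $\overline\pi:CV\to V$, $(T_+,s,T_-)\mapsto(T_+,\pi_n(s),T_-)$, is a surjective homomorphism, and the pure cactus Thompson group is $PCV:=\ker\overline\pi$. *)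

(* Defs.v *)
From HB Require Import structures.
From Stdlib Require Import Relations.
Set Warnings "-notation-overridden,-redundant-canonical-projection".
From mathcomp Require Import all_boot all_fingroup.
From mathcomp Require Import boolp zify.

Set Implicit Arguments.
Unset Strict Implicit.
Unset Printing Implicit Defensive.

Local Open Scope quotient_scope.
Local Open Scope group_scope.

Section GeneratedQuotient.
Variables (T : Type) (R : T -> T -> Prop).

Definition gen_equiv : rel {classic T} :=
  fun x y => `[< clos_refl_sym_trans T R x y >].

Lemma gen_equiv_is_equiv : equiv_class_of gen_equiv.
Proof.
split=> [x|x y|y x z].
- by apply/asboolP; apply: rst_refl.
- by apply/asboolP/asboolP => h; apply: rst_sym.
- by move=> /asboolP xy /asboolP yz; apply/asboolP; apply: rst_trans xy yz.
Qed.

Canonical gen_equiv_equiv := EquivRelPack gen_equiv_is_equiv.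

Definition gen_quot := {eq_quot gen_equiv}.
HB.instance Definition _ := Choice.on gen_quot.

Definition cls (x : T) : gen_quot := \pi_gen_quot (x : {classic T}).
Definition rep (c : gen_quot) : T := generic_quotient.repr c.

Lemma repK : cancel rep cls. Proof. exact: reprK. Qed.

Lemma clsP x y : cls x = cls y <-> clos_refl_sym_trans T R x y.
Proof.
by split=> [/eqmodP/asboolP|h]; last by apply/eqmodP/asboolP.
Qed.

Lemma cls_step x y : R x y -> cls x = cls y.
Proof. by move=> h; apply/clsP/rst_step. Qed.

Lemma clsW (P : gen_quot -> Prop) : (forall x, P (cls x)) -> forall c, P c.
Proof. by move=> h c; rewrite -(repK c). Qed.

Lemma rep_cls (A : Type) (f : T -> A) :
  (forall x y, R x y -> f x = f y) -> forall x, f (rep (cls x)) = f x.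
Proof.
move=> fR x; have /clsP := repK (cls x); move: (rep (cls x)) => y.
by elim=> [? ? /fR||? ? _ ->|? ? ? _ -> _ ->].
Qed.

End GeneratedQuotient.

Inductive btree := Leaf | Node of btree & btree.

Fixpoint leaves (t : btree) : nat :=
  if t is Node l r then (leaves l + leaves r)%N else 1.

(* Leaves are numbered 0, ..., n - 1 from left to right. An out-of-range [i]
   designates the last leaf; this never happens in [attach]. *)
Fixpoint battach (t : btree) (i : nat) : btree :=
  match t with
  | Leaf => Node Leaf Leaf
  | Node l r =>
      if (i < leaves l)%N then Node (battach l i) r
      else Node l (battach r (i - leaves l))
  end.

Lemma leaves_battach t i : leaves (battach t i) = (leaves t).+1.
Proof.
by elim: t i => //= l IHl r IHr i; case: ifP => _ /=; rewrite ?IHl ?IHr; lia.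
Qed.

Definition tree (n : nat) : Type := {t : btree | leaves t = n}.

Definition attach n (t : tree n) (i : 'I_n) : tree n.+1 :=
  exist _ (battach (sval t) i)
    (etrans (leaves_battach (sval t) i) (congr1 S (svalP t))).

Lemma tree_inj n (s t : tree n) : sval s = sval t -> s = t.
Proof.
by case: s t => [s hs] [t ht] /= e; subst t; rewrite (eq_irrelevance hs ht).
Qed.

Lemma leaves_gt0 t : (0 < leaves t)%N.
Proof. by elim: t => //= l ? r ?; lia. Qed.

Lemma bumpE h k : bump h k = if (h <= k)%N then k.+1 else k.
Proof. by rewrite /bump; case: leqP. Qed.

Lemma bumpS_gt i j : (i < j)%N -> bump i.+1 j = j.+1.
Proof. by rewrite bumpE => ->. Qed.

Lemma bumpS_lt i j : (j < i)%N -> bump i.+1 j = j.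
Proof. by move=> ji; rewrite bumpE ltnNge (ltnW ji). Qed.

Lemma battachC_lt t i j : (i < j)%N -> (j < leaves t)%N ->
  battach (battach t i) j.+1 = battach (battach t j) i.
Proof.
elim: t i j => [|l IHl r IHr] i j /= ij jl; first by lia.
have [jll|jll] := ltnP j (leaves l).
  by rewrite ifT ?[(i < leaves l)%N]ifT /= ?leaves_battach ?ifT ?IHl //; lia.
have [ill|ill] := ltnP i (leaves l).
  by rewrite /= leaves_battach ifN ?ill ?subSS //; lia.
rewrite /= !ifN ?subSn ?IHr //; lia.
Qed.

Lemma battachC t i j : (i < leaves t)%N -> (j < leaves t)%N -> i <> j ->
  battach (battach t i) (bump i.+1 j) = battach (battach t j) (bump j.+1 i).
Proof.
move=> il jl; case: (ltngtP i j) => // ij _.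
- by rewrite bumpS_gt // bumpS_lt // battachC_lt.
- by rewrite bumpS_lt // bumpS_gt // battachC_lt.
Qed.

Fixpoint tle (s t : btree) : bool :=
  match s, t with
  | Leaf, _ => true
  | Node a b, Node c d => tle a c && tle b d
  | Node _ _, Leaf => false
  end.

Fixpoint tjoin (s t : btree) : btree :=
  match s, t with
  | Leaf, _ => t
  | _, Leaf => s
  | Node a b, Node c d => Node (tjoin a c) (tjoin b d)
  end.

Lemma tle_refl t : tle t t. Proof. by elim: t => //= l -> r ->. Qed.

Lemma tle_joinl s t : tle s (tjoin s t).
Proof.
elim: s t => // a IHa b IHb [|c d] /=; first by rewrite !tle_refl.
by rewrite IHa IHb.
Qed.

Lemma tle_joinr s t : tle t (tjoin s t).
Proof.
elim: s t => [|a IHa b IHb [|c d]] //=; first exact: tle_refl.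
by rewrite IHa IHb.
Qed.

Lemma tle_leaves s t : tle s t -> (leaves s <= leaves t)%N.
Proof.
elim: s t => [|a IHa b IHb] [|c d] //=; first by have := leaves_gt0 c; lia.
by case/andP=> /IHa ? /IHb ?; lia.
Qed.

Lemma tle_attach t i : tle t (battach t i).
Proof.
elim: t i => //= l IHl r IHr i.
by case: ifP => _; rewrite ?IHl ?IHr tle_refl.
Qed.

Lemma tle_trans s t u : tle s t -> tle t u -> tle s u.
Proof.
elim: s t u => // a IHa b IHb [|c d] // [|e f] //=.
by case/andP=> ac bd /andP[ce df]; rewrite (IHa _ _ ac ce) (IHb _ _ bd df).
Qed.

Lemma tle_ex s t : tle s t -> s <> t ->
  exists2 i, (i < leaves s)%N & tle (battach s i) t.
Proof.
elim: s t => [|a IHa b IHb] [|c d] //=; first by exists 0%N.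
case/andP=> ac bd ne.
have [eac|/(IHa _ ac)[i ia h]] := pselect (a = c).
  have [ebd|/(IHb _ bd)[i ib h]] := pselect (b = d).
    by case: ne; rewrite eac ebd.
  exists (leaves a + i)%N; first by lia.
  by rewrite ifN /=; [rewrite ac addKn h|lia].
by exists i; [lia|rewrite ia /= h bd].
Qed.

Lemma tle_attach2 s t i j :
  (i < leaves s)%N -> (j < leaves s)%N -> i <> j ->
  tle (battach s i) t -> tle (battach s j) t ->
  tle (battach (battach s i) (bump i.+1 j)) t.
Proof.
elim: s t i j => [|a IHa b IHb] t i j /=; first by lia.
move=> il jl ij; rewrite bumpE.
have [ia|ia] := ltnP i (leaves a); have [ja|ja] := ltnP j (leaves a).
- case: t => //= c d /andP[h1 hb] /andP[h2 _].
  rewrite leaves_battach ifT; last by case: ifP; lia.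
  by rewrite /= hb andbT; have := IHa c i j; rewrite bumpE; apply.
- case: t => //= c d /andP[h1 hb] /andP[_ h2].
  rewrite leaves_battach ifN; last by case: ifP; lia.
  rewrite /= h1 /= ifT; last by lia.
  by rewrite subSS h2.
- case: t => //= c d /andP[h1 hb] /andP[h2 _].
  rewrite ifT; last by case: ifP; lia.
  by rewrite /= hb andbT ifN //; lia.
- case: t => //= c d /andP[h1 hb] /andP[_ h2].
  rewrite ifN; last by case: ifP; lia.
  rewrite /= h1 /=; have := IHb d (i - leaves a)%N (j - leaves a)%N.
  rewrite bumpE.
  have -> : (i - leaves a < j - leaves a)%N = (i < j)%N by lia.
  have -> : ((if (i < j)%N then j.+1 else j) - leaves a)%N
          = (if (i < j)%N then (j - leaves a).+1 else (j - leaves a)%N).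
    by case: ifP; lia.
  by apply=> //; lia.
Qed.

(* When leaf [i] of a tree with [n] leaves receives a caret, its right child
   has number [i + 1] = [rchild i]; the old leaf [j] (for [j = i]: the left
   child) gets number [newpos i j]. *)
Definition rchild n (i : 'I_n) : 'I_n.+1 := lift ord0 i.
Definition newpos n (i j : 'I_n) : 'I_n.+1 := lift (rchild i) j.

Lemma val_newpos n (i j : 'I_n) : newpos i j = bump i.+1 j :> nat.
Proof. by []. Qed.

Lemma val_rchild n (i : 'I_n) : rchild i = i.+1 :> nat.
Proof. by []. Qed.

(* The permutation of [n + 1] leaves induced by [s] when carets are attached to
   leaf [i] of the source and to leaf [s i] of the target: it sends [rchild i]
   to [rchild (s i)] and [newpos i j] to [newpos (s i) (s j)]. *)
Definition perm_clone n (i : 'I_n) (s : 'S_n) : 'S_n.+1 :=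
  lift_perm (rchild i) (rchild (s i)) s.

Lemma perm_clone_rchild n (i : 'I_n) (s : 'S_n) :
  perm_clone i s (rchild i) = rchild (s i).
Proof. exact: lift_perm_id. Qed.

Lemma perm_clone_newpos n (i j : 'I_n) (s : 'S_n) :
  perm_clone i s (newpos i j) = newpos (s i) (s j).
Proof. exact: lift_perm_lift. Qed.

(* The data from which both V (G_n = S_n) and CV (G_n = J_n) are built, a
   "cloning system": groups G_n with homomorphisms to S_n, and maps
   [cclone i] : G_n -> G_(n+1), not homomorphisms in general, giving the middle
   entry of the expansion at leaf [i]. *)
Record cloning := Cloning {
  cgrp :> nat -> groupType;
  cperm : forall n, cgrp n -> 'S_n;
  cclone : forall n, 'I_n -> cgrp n -> cgrp n.+1;
  cpermM : forall n, {morph @cperm n : s t / s * t};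
  ccloneM : forall n (i : 'I_n) (s t : cgrp n),
    cclone i (s * t) = cclone i s * cclone (cperm s i) t;
  cperm_clone : forall n (i : 'I_n) (s : cgrp n),
    cperm (cclone i s) = perm_clone i (cperm s);
  ccloneC : forall n (i j : 'I_n) (s : cgrp n), i <> j ->
    cclone (newpos i j) (cclone i s) = cclone (newpos j i) (cclone j s)
}.

Section Thompson.
Variable C : cloning.

Record tpair := TPair {
  tsize : nat;
  tsrc : tree tsize;
  tmid : C tsize;
  ttgt : tree tsize
}.

Definition expand (X : tpair) (i : 'I_(tsize X)) : tpair :=
  TPair (attach (tsrc X) i) (cclone i (tmid X))
        (attach (ttgt X) (cperm (tmid X) i)).

Arguments expand X i : clear implicits.

Definition expansion (X Y : tpair) : Prop := exists i, Y = expand X i.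

Definition thompson := gen_quot expansion.
HB.instance Definition _ := Choice.on thompson.

Definition tcls (X : tpair) : thompson := cls expansion X.

Lemma cperm1 n : cperm (1 : C n) = 1.
Proof. by apply: (mulgI (cperm (1 : C n))); rewrite -cpermM !mulg1. Qed.

Lemma cpermV n (s : C n) : cperm s^-1 = (cperm s)^-1.
Proof. by apply: (mulgI (cperm s)); rewrite -cpermM !mulgV cperm1. Qed.

Lemma cclone1 n (i : 'I_n) : cclone i (1 : C n) = 1.
Proof.
apply: (@mulgI _ (cclone i 1)).
by rewrite -{2}(perm1 i) -cperm1 -ccloneM !mulg1.
Qed.

Lemma ccloneV n (i : 'I_n) (s : C n) :
  cclone (cperm s i) s^-1 = (cclone i s)^-1.
Proof. by apply: (mulgI (cclone i s)); rewrite -ccloneM !mulgV cclone1. Qed.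

Lemma attachC n (t : tree n) (i j : 'I_n) : i <> j ->
  attach (attach t i) (newpos i j) = attach (attach t j) (newpos j i).
Proof.
case: t => t ht ij; apply: tree_inj => /=.
by apply: battachC; rewrite ?ht //; move/val_inj.
Qed.

Lemma expandC (X : tpair) (i j : 'I_(tsize X)) : i <> j ->
  expand (expand X i) (newpos i j) = expand (expand X j) (newpos j i).
Proof.
case: X i j => n A s B /= i j ij; rewrite /expand /= ccloneC //.
rewrite !cperm_clone !perm_clone_newpos attachC //.
by rewrite [attach (attach B _) _]attachC // => /perm_inj.
Qed.

Definition expands := clos_refl_trans_1n tpair expansion.

Lemma expands_refl X : expands X X. Proof. exact: rt1n_refl. Qed.

Lemma expands_cons X Y Z : expansion X Y -> expands Y Z -> expands X Z.
Proof. exact: Relation_Operators.rt1n_trans. Qed.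

Lemma expands_trans X Y Z : expands X Y -> expands Y Z -> expands X Z.
Proof. by elim=> // ? ? ? h _ IH /IH; apply: expands_cons. Qed.

Lemma expands_step X (i : 'I_(tsize X)) : expands X (expand X i).
Proof. by apply: expands_cons (expands_refl _); exists i. Qed.

Lemma expands_cls X Y : expands X Y -> tcls X = tcls Y.
Proof. by elim=> // ? ? ? h _ <-; apply: cls_step. Qed.

Lemma expands_le X Y : expands X Y ->
  tle (sval (tsrc X)) (sval (tsrc Y)) /\ tle (sval (ttgt X)) (sval (ttgt Y)).
Proof.
elim=> [Z|Z W U [i eW] _ [h1 h2]]; first by rewrite !tle_refl.
subst W; move: h1 h2 => /= h1 h2.
by split; [apply: tle_trans h1|apply: tle_trans h2]; apply: tle_attach.
Qed.

Lemma expands_size X Y : expands X Y -> (tsize X <= tsize Y)%N.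
Proof.
case/expands_le=> /tle_leaves + _.
by rewrite (svalP (tsrc X)) (svalP (tsrc Y)).
Qed.

Lemma expands_src X (t : btree) : tle (sval (tsrc X)) t ->
  exists2 Y, expands X Y & sval (tsrc Y) = t.
Proof.
have [k] := ubnP (leaves t - tsize X); elim: k X => // k IH X lek le.
have [e|ne] := pselect (sval (tsrc X) = t).
  by exists X => //; apply: expands_refl.
have [i] := tle_ex le ne; rewrite (svalP (tsrc X)) => ilt hi.
have ltX : (tsize X < leaves t)%N.
  by have := tle_leaves hi; rewrite leaves_battach (svalP (tsrc X)).
have [||Y XY <-] := IH (expand X (Ordinal ilt)); [rewrite /=; lia|exact: hi|].
by exists Y => //; apply: expands_trans XY; apply: expands_step.
Qed.

Lemma expands_src_inj X Y Z : expands X Y -> expands X Z ->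
  sval (tsrc Y) = sval (tsrc Z) -> Y = Z.
Proof.
have [k] := ubnP (tsize Y - tsize X); elim: k X Y Z => // k IH X Y Z lek.
move=> XY; case: XY lek => [|X1 Y' XX1 X1Y] lek.
  case=> [//|X2 Z' [i ->] /expands_size XZ e].
  by move: XZ; rewrite -(svalP (tsrc Z')) -e (svalP (tsrc X)) /= ltnn.
case=> [|X2 Z' XX2 X2Z] e.
  case: XX1 X1Y => [i ->] /expands_size.
  by rewrite -(svalP (tsrc Y')) e (svalP (tsrc X)) /= ltnn.
case: XX1 XX2 X1Y X2Z => [i ->] [j ->] iY jZ.
have szYZ : tsize Y' = tsize Z' by rewrite -(svalP (tsrc Y')) e (svalP (tsrc Z')).
have := expands_size iY => /= szX.
have [eij|/eqP ij] := eqVneq i j.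
  subst j; apply: IH iY jZ e => /=. lia.
have [W XW eW] : exists2 W, expands (expand (expand X i) (newpos i j)) W &
    sval (tsrc W) = sval (tsrc Y').
  apply: expands_src => /=; apply: tle_attach2.
  - by rewrite (svalP (tsrc X)).
  - by rewrite (svalP (tsrc X)).
  - by move/val_inj.
  - exact: (expands_le iY).1.
  - by rewrite e; exact: (expands_le jZ).1.
have -> : Y' = W.
  apply: (IH (expand X i)) => //=; [lia|].
  by apply: expands_trans XW; apply: expands_step.
apply/esym/(IH (expand X j)) => //=; [lia| |by rewrite -e].
by rewrite expandC // in XW; apply: expands_trans XW; apply: expands_step.
Qed.

Lemma expands_conf X Y Z : expands X Y -> expands X Z ->
  exists2 W, expands Y W & expands Z W.
Proof.
move=> XY XZ.
have [W1 YW1 e1] := expands_src (tle_joinl (sval (tsrc Y)) (sval (tsrc Z))).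
have [W2 ZW2 e2] := expands_src (tle_joinr (sval (tsrc Y)) (sval (tsrc Z))).
exists W1 => //; rewrite (@expands_src_inj X W1 W2) ?e1 //.
- exact: expands_trans YW1.
- exact: expands_trans ZW2.
Qed.

Lemma tcls_eq X Y : tcls X = tcls Y ->
  exists2 Z, expands X Z & expands Y Z.
Proof.
move/clsP; elim=> [U V [i ->]|U|U V _ [W]|U V W _ [P UP VP] _ [Q VQ WQ]].
- by exists (expand U i); [apply: expands_step|apply: expands_refl].
- by exists U; apply: expands_refl.
- by exists W.
- have [R PR QR] := expands_conf VP VQ.
  by exists R; [apply: expands_trans PR|apply: expands_trans QR].
Qed.

Definition tinv (X : tpair) : tpair := TPair (ttgt X) (tmid X)^-1 (tsrc X).

Lemma tinvK : involutive tinv.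
Proof. by case=> n A s B; rewrite /tinv /= invgK. Qed.

Lemma tinv_expand X (i : 'I_(tsize X)) :
  tinv (expand X i) = expand (tinv X) (cperm (tmid X) i).
Proof.
case: X i => n A s B i; rewrite /tinv /expand /=.
by rewrite ccloneV cpermV permK.
Qed.

Lemma tinv_expands X Y : expands X Y -> expands (tinv X) (tinv Y).
Proof.
elim=> [Z|Z W U [i ->] _]; first exact: expands_refl.
by rewrite tinv_expand; apply: expands_trans; apply: expands_step.
Qed.

Lemma expands_tgt X (t : btree) : tle (sval (ttgt X)) t ->
  exists2 Y, expands X Y & sval (ttgt Y) = t.
Proof.
move=> le; have [Y h <-] := @expands_src (tinv X) t le.
by exists (tinv Y) => //; rewrite -(tinvK X); apply: tinv_expands.
Qed.

Lemma TPair_inj n (A A' B B' : tree n) (s s' : C n) :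
  TPair A s B = TPair A' s' B' -> [/\ A = A', s = s' & B = B'].
Proof.
pose F (X : tpair) := existT (fun k => (tree k * C k * tree k)%type) (tsize X)
  (tsrc X, tmid X, ttgt X).
move=> /(congr1 F) e.
by have [-> -> ->] := Eqdep_dec.inj_pair2_eq_dec _ PeanoNat.Nat.eq_dec _ _ _ _ e.
Qed.

(* [z] is obtained from representatives of [x] and [y] with equal inner trees;
   [is_prod_ex] and [is_prod_fun] below show that there is exactly one such
   [z]. *)
Definition is_prod (x y z : thompson) : Prop :=
  exists n (A M B : tree n) (s t : C n),
    [/\ x = tcls (TPair A s M), y = tcls (TPair M t B) &
        z = tcls (TPair A (s * t) B)].

Lemma tpair_match X Y : sval (ttgt X) = sval (tsrc Y) ->
  exists n (A M B : tree n) (s t : C n), X = TPair A s M /\ Y = TPair M t B.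
Proof.
case: X Y => n A s M [m M' t B] /= e.
have nm : n = m by rewrite -(svalP M) e (svalP M').
by subst m; exists n, A, M, B, s, t; rewrite (tree_inj e).
Qed.

Lemma is_prod_ex x y : exists z, is_prod x y z.
Proof.
move: x y; apply: clsW => X; apply: clsW => Y.
have [X' XX' e1] := expands_tgt (tle_joinl (sval (ttgt X)) (sval (tsrc Y))).
have [Y' YY' e2] := expands_src (tle_joinr (sval (ttgt X)) (sval (tsrc Y))).
have [|n [A [M [B [s [t [eX eY]]]]]]] := @tpair_match X' Y'; first by rewrite e1.
exists (tcls (TPair A (s * t) B)), n, A, M, B, s, t.
by rewrite -eX -eY; split=> //; apply: expands_cls.
Qed.

Lemma expands_mul n m (A M B : tree n) (s t : C n) (A' M' B' : tree m)
    (s' t' : C m) :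
  expands (TPair A s M) (TPair A' s' M') ->
  expands (TPair M t B) (TPair M' t' B') ->
  expands (TPair A (s * t) B) (TPair A' (s' * t') B').
Proof.
move: {-1}(TPair A s M) (erefl (TPair A s M)) => X eX.
move: {-1}(TPair A' s' M') (erefl (TPair A' s' M')) => X' eX' h.
elim: h n A M B s t eX eX' => {X X'} [X|X Y Z [i eY] YZ IH] n A M B s t.
  move=> eX e; subst X; have mn : m = n := congr1 tsize e.
  subst m; case: (TPair_inj e) => -> -> -> h.
  have e' := expands_src_inj h (expands_refl _) erefl.
  by case: (TPair_inj e') => _ -> ->; apply: expands_refl.
move=> eX eZ h; subst X Y Z; move: i YZ IH => /= i YZ IH.
set j := cperm s i.
have [W XW eW] : exists2 W, expands (expand (TPair M t B) j) W &
    sval (tsrc W) = sval M'.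
  by apply: expands_src; exact: (expands_le YZ).2.
have e' : TPair M' t' B' = W.
  by apply: expands_src_inj h _ _ => //; apply: expands_trans XW; apply: expands_step.
subst W; apply: expands_cons; first by exists i.
have := IH _ _ _ _ _ _ erefl erefl XW.
by rewrite /expand /= ccloneM cpermM permM.
Qed.

Lemma tcls_same n (A A' B B' : tree n) (s s' : C n) : A = A' -> s = s' -> B = B' ->
  tcls (TPair A s B) = tcls (TPair A' s' B').
Proof. by move=> -> -> ->. Qed.

Lemma is_prod_fun x y z z' : is_prod x y z -> is_prod x y z' -> z = z'.
Proof.
move=> [n [A [M [B [s [t [-> -> ->]]]]]]] [m [A' [M' [B' [s' [t' [e1 e2 ->]]]]]]].
have [X X1 X2] := tcls_eq e1; have [Y Y1 Y2] := tcls_eq e2.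
have [V XV eV] := expands_tgt (tle_joinl (sval (ttgt X)) (sval (tsrc Y))).
have [W YW eW] := expands_src (tle_joinr (sval (ttgt X)) (sval (tsrc Y))).
have [|k [P [Q [R [u [v [eP eQ]]]]]]] := @tpair_match V W; first by rewrite eV.
subst V W.
rewrite (expands_cls (expands_mul (expands_trans X1 XV) (expands_trans Y1 YW))).
by rewrite (expands_cls (expands_mul (expands_trans X2 XV) (expands_trans Y2 YW))).
Qed.

Definition tmul (x y : thompson) : thompson := sval (cid (is_prod_ex x y)).

Lemma tmulP x y : is_prod x y (tmul x y).
Proof. exact: svalP (cid (is_prod_ex x y)). Qed.

Lemma tmulE n (A M B : tree n) (s t : C n) :
  tmul (tcls (TPair A s M)) (tcls (TPair M t B)) = tcls (TPair A (s * t) B).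
Proof. by apply: is_prod_fun (tmulP _ _) _; exists n, A, M, B, s, t. Qed.

Definition tleaf : tree 1 := exist _ Leaf erefl.

Definition tone : thompson := tcls (TPair tleaf 1 tleaf).

Definition tinvc (x : thompson) : thompson := tcls (tinv (rep x)).

Lemma tinvcE X : tinvc (tcls X) = tcls (tinv X).
Proof.
apply: (rep_cls (f := tcls \o tinv)) => {}X _ [i ->] /=.
by rewrite tinv_expand; apply/expands_cls/expands_step.
Qed.

Lemma toneE n (A : tree n) : tcls (TPair A 1 A) = tone.
Proof.
have [[m A' s B] XW /= e] := @expands_src (TPair tleaf 1 tleaf) (sval A) isT.
have mn : m = n by rewrite -(svalP A') e (svalP A).
subst m; rewrite (tree_inj e) {e A'} in XW.
suff e : TPair A s B = TPair A 1 A by rewrite /tone (expands_cls XW) e.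
have : forall X Y, expands X Y -> tmid X = 1 -> sval (tsrc X) = sval (ttgt X) ->
  tmid Y = 1 /\ sval (tsrc Y) = sval (ttgt Y).
  move=> X Y; elim=> [//|U V Z [i eV] _ IH u1 eU]; apply: IH; subst V => /=.
    by rewrite u1 cclone1.
  by rewrite u1 cperm1 perm1 eU.
by case/(_ _ _ XW erefl erefl) => /= -> e; rewrite (tree_inj e).
Qed.

Lemma tmulA : associative tmul.
Proof.
move=> x y z.
have [n [A [M [B [s [t [-> -> _]]]]]]] := tmulP x y.
elim/clsW: z => Z.
have [Y' YY' e1] := @expands_tgt (TPair M t B) _ (tle_joinl (sval B) (sval (tsrc Z))).
have [Z' ZZ' e2] := expands_src (tle_joinr (sval B) (sval (tsrc Z))).
have [|k [P [Q [R [u [v [eP eQ]]]]]]] := @tpair_match Y' Z'; first by rewrite e1.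
subst Y' Z'.
have [X' XX' e3] := @expands_tgt (TPair A s M) _ (expands_le YY').1.
have [|l [P' [Q' [R' [u' [v' [eP' eQ']]]]]]] := @tpair_match X' (TPair P u Q).
  by rewrite e3.
have lk : k = l := congr1 tsize eQ'.
subst l X'; case: (TPair_inj eQ') => ? ? ?; subst Q' v' R'.
rewrite -[cls _ Z]/(tcls Z) (expands_cls XX') (expands_cls YY') (expands_cls ZZ').
by rewrite !tmulE mulgA.
Qed.

Lemma tmul1 : left_id tone tmul.
Proof.
by elim/clsW=> -[n A s B]; rewrite -(toneE A) -[cls _ _]/(tcls _) tmulE mul1g.
Qed.

Lemma tmulx1 : right_id tone tmul.
Proof.
by elim/clsW=> -[n A s B]; rewrite -(toneE B) -[cls _ _]/(tcls _) tmulE mulg1.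
Qed.

Lemma tmulV : left_inverse tone tinvc tmul.
Proof.
elim/clsW=> -[n A s B]; rewrite -[cls _ _]/(tcls _) tinvcE tmulE mulVg.
exact: toneE.
Qed.

Lemma tmulxV : right_inverse tone tinvc tmul.
Proof.
elim/clsW=> -[n A s B]; rewrite -[cls _ _]/(tcls _) tinvcE tmulE mulgV.
exact: toneE.
Qed.

HB.instance Definition _ := isGroup.Build thompson
  tmulA tmul1 tmulx1 tmulV tmulxV.

End Thompson.

Arguments tone {C}.
Arguments tcls {C} X.
Arguments expand {C} X i.

Lemma newposA n (i j k : 'I_n) : i <> j ->
  newpos (newpos i j) (newpos i k) = newpos (newpos j i) (newpos j k).
Proof.
move=> ij; have {}ij : i <> j :> nat by move/ord_inj.
apply: ord_inj; rewrite !val_newpos; move: ij.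
move: (i : nat) (j : nat) (k : nat) => {}i {}j {}k.
by case: (ltngtP i j) => // ij _; rewrite (bumpS_gt ij) (bumpS_lt ij) !bumpE;
  case: (ltnP i k) => ?; case: (ltnP j k) => ?; do ?[case: ifP => ?]; lia.
Qed.

Lemma newpos_rchild n (i j : 'I_n) : i <> j ->
  newpos (newpos i j) (rchild i) = rchild (newpos j i).
Proof.
move=> ij; have {}ij : i <> j :> nat by move/ord_inj.
apply: ord_inj; rewrite !(val_newpos, val_rchild); move: ij.
move: (i : nat) (j : nat) => {}i {}j.
by case: (ltngtP i j) => // ij _; rewrite (bumpS_gt ij) (bumpS_lt ij) bumpE;
  case: ifP; lia.
Qed.

Lemma leaf_cases n (i : 'I_n) (P : 'I_n.+1 -> Prop) :
  P (rchild i) -> (forall k, P (newpos i k)) -> forall x, P x.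
Proof. by move=> h1 h2 x; case: (unliftP (rchild i) x) => [k|] ->; [apply: h2|]. Qed.

Lemma perm_cloneM n (i : 'I_n) (s t : 'S_n) :
  perm_clone i (s * t) = perm_clone i s * perm_clone (s i) t.
Proof. by rewrite /perm_clone lift_permM permM. Qed.

Lemma perm_cloneC n (i j : 'I_n) (s : 'S_n) : i <> j ->
  perm_clone (newpos i j) (perm_clone i s)
  = perm_clone (newpos j i) (perm_clone j s).
Proof.
move=> ij; have sij : s i <> s j by move/perm_inj.
have ji := nesym ij; have sji := nesym sij.
apply/permP; apply: (@leaf_cases _ (newpos i j)).
  rewrite perm_clone_rchild perm_clone_newpos -!newpos_rchild //.
  by rewrite !(perm_clone_newpos, perm_clone_rchild) -?newpos_rchild.
apply: (@leaf_cases _ i) => [|k].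
  rewrite perm_clone_newpos newpos_rchild //.
  by rewrite !(perm_clone_newpos, perm_clone_rchild) newpos_rchild.
rewrite perm_clone_newpos newposA // !perm_clone_newpos newposA //.
Qed.

Definition perm_cloning : cloning :=
  @Cloning (fun n => 'S_n) (fun n s => s) perm_clone (fun n s t => erefl)
    perm_cloneM (fun n i s => erefl) perm_cloneC.

Definition V : groupType := thompson perm_cloning.

(* The generator s_(lo, hi) of J_n, with strands numbered 0, ..., n - 1. *)
Record cgen n := CGen { lo : nat; hi : nat; cgenP : (lo < hi < n)%N }.

Inductive cactus_rel n : seq (cgen n) -> seq (cgen n) -> Prop :=
| crel_invol (g : cgen n) : cactus_rel [:: g; g] [::]
| crel_disjoint (g h : cgen n) :
    (hi g < lo h)%N -> cactus_rel [:: g; h] [:: h; g]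
| crel_nested (g h h' : cgen n) :
    (lo g <= lo h)%N -> (hi h <= hi g)%N ->
    lo h' = (lo g + hi g - hi h)%N -> hi h' = (lo g + hi g - lo h)%N ->
    cactus_rel [:: g; h] [:: h'; g].

Inductive cactus_step n : seq (cgen n) -> seq (cgen n) -> Prop :=
| CactusStep u v l r :
    cactus_rel l r -> cactus_step (u ++ l ++ v) (u ++ r ++ v).

(* The generators are involutions, so that J_n is also the monoid with this
   presentation: words need no formal inverses. *)
Definition cactus n := gen_quot (@cactus_step n).
HB.instance Definition _ n := Choice.on (cactus n).

Section CactusGroup.
Variable n : nat.
Implicit Types (x y z : cactus n) (u v w : seq (cgen n)).

Definition word w : cactus n := cls (@cactus_step n) w.

Lemma wordW (P : cactus n -> Prop) : (forall w, P (word w)) -> forall x, P x.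
Proof. exact: clsW. Qed.

Definition cactus_mul x y : cactus n := word (rep x ++ rep y).
Definition cactus_inv x : cactus n := word (rev (rep x)).

Lemma word_rel u v l r : cactus_rel l r -> word (u ++ l ++ v) = word (u ++ r ++ v).
Proof. by move=> h; apply: cls_step. Qed.

Lemma word_rel1 l r : cactus_rel l r -> word l = word r.
Proof. by move/(word_rel [::] [::]); rewrite /= !cats0. Qed.

Lemma wordM u v : cactus_mul (word u) (word v) = word (u ++ v).
Proof.
rewrite /cactus_mul.
rewrite (rep_cls (f := fun w => word (w ++ rep (word v)))); last first.
  by move=> _ _ [a b l r h]; rewrite -!catA; apply: word_rel.
rewrite (rep_cls (f := fun w => word (u ++ w))) // => _ _ [a b l r h].
by rewrite !(catA u); apply: word_rel.
Qed.

Lemma word_rev w : word (rev w ++ w) = word [::].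
Proof.
elim: w => // g w IH; rewrite rev_cons cat_rcons.
by rewrite -[g :: g :: w]/([:: g; g] ++ w) (word_rel _ _ (crel_invol g)).
Qed.

Lemma cactus_mulA : associative cactus_mul.
Proof.
by elim/wordW=> u; elim/wordW=> v; elim/wordW=> w; rewrite !wordM catA.
Qed.

Lemma cactus_mul1 : left_id (word [::]) cactus_mul.
Proof. by elim/wordW=> u; rewrite wordM. Qed.

Lemma cactus_mulx1 : right_id (word [::]) cactus_mul.
Proof. by elim/wordW=> u; rewrite wordM cats0. Qed.

Lemma cactus_mulV : left_inverse (word [::]) cactus_inv cactus_mul.
Proof. by move=> x; rewrite -{2}(repK x) wordM word_rev. Qed.

Lemma cactus_mulxV : right_inverse (word [::]) cactus_inv cactus_mul.
Proof. by move=> x; rewrite -{1}(repK x) wordM -{1}(revK (rep x)) word_rev. Qed.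

HB.instance Definition _ := isGroup.Build (cactus n)
  cactus_mulA cactus_mul1 cactus_mulx1 cactus_mulV cactus_mulxV.

Lemma word_nil : word [::] = 1. Proof. by []. Qed.

Lemma word_cat u v : word (u ++ v) = word u * word v.
Proof. by rewrite -wordM. Qed.

Lemma word_cons g w : word (g :: w) = word [:: g] * word w.
Proof. exact: (word_cat [:: g]). Qed.

End CactusGroup.

Section Generators.
Variable n : nat.

(* s_(i, j) as an element of J_n; the value 1 when i < j < n fails is junk. *)
Definition sgen (i j : nat) : cactus n :=
  if @idP (i < j < n)%N is ReflectT h then word [:: CGen h] else 1.

Lemma sgen0 i j : ~~ (i < j < n)%N -> sgen i j = 1.
Proof. by rewrite /sgen; case: {-}_ / idP => // h /negP. Qed.

Lemma sgenE (g : cgen n) : word [:: g] = sgen (lo g) (hi g).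
Proof.
case: g => i j h /=; rewrite /sgen; case: {-}_ / idP => // h'.
by rewrite (bool_irrelevance h h').
Qed.

Lemma sgen_ex i j : (i < j < n)%N ->
  exists2 g : cgen n, sgen i j = word [:: g] & lo g = i /\ hi g = j.
Proof. by move=> h; exists (CGen h) => //; rewrite sgenE. Qed.

Lemma sgenK i j : sgen i j * sgen i j = 1.
Proof.
have [/sgen_ex[g -> _]|/sgen0->] := boolP (i < j < n)%N; last exact: mulg1.
by rewrite -word_cat; apply: (word_rel1 (crel_invol g)).
Qed.

Lemma sgenC i j k l : (j < k)%N -> sgen i j * sgen k l = sgen k l * sgen i j.
Proof.
move=> jk.
have [/sgen_ex[g -> [_ gj]]|/sgen0->] := boolP (i < j < n)%N; last by rewrite mulg1 mul1g.
have [/sgen_ex[h -> [hk _]]|/sgen0->] := boolP (k < l < n)%N; last by rewrite mulg1 mul1g.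
rewrite -!word_cat; apply: word_rel1; apply: crel_disjoint.
by rewrite gj hk.
Qed.

Lemma sgenN i j k l : (i <= k)%N -> (l <= j)%N -> (j < n)%N ->
  sgen i j * sgen k l = sgen (i + j - l) (i + j - k) * sgen i j.
Proof.
move=> ik lj jn.
have [kl|kl] := ltnP k l; last by rewrite (@sgen0 k) ?(@sgen0 (_ - _)) ?mulg1 ?mul1g //; lia.
have [|g -> [gi gj]] := @sgen_ex i j; first by lia.
have [|h -> [hk hl]] := @sgen_ex k l; first by lia.
have [|h' -> [hk' hl']] := @sgen_ex (i + j - l) (i + j - k); first by lia.
rewrite -!word_cat; apply: word_rel1; apply: crel_nested; lia.
Qed.

End Generators.

Definition flip (i j m : nat) : nat := if (i <= m <= j)%N then (i + j - m)%N else m.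

Lemma flip_lt n i j m : (j < n)%N -> (m < n)%N -> (flip i j m < n)%N.
Proof. by rewrite /flip; case: ifP; lia. Qed.

Lemma flip_spec i j m :
  (i <= m <= j)%N /\ flip i j m = (i + j - m)%N \/
  ~ (i <= m <= j)%N /\ flip i j m = m.
Proof. by rewrite /flip; case: ifP => h; [left|right]. Qed.

Lemma bump_spec h k :
  (h <= k)%N /\ bump h k = k.+1 \/ (k < h)%N /\ bump h k = k.
Proof. by rewrite bumpE; case: leqP; [left|right]. Qed.

Lemma flipK i j m : flip i j (flip i j m) = m.
Proof. by rewrite /flip; do !case: ifP; lia. Qed.

Lemma flip_lo i j p : (p < i)%N -> flip i j p = p.
Proof. by move=> h; rewrite /flip ifN //; lia. Qed.

Lemma flip_hi i j p : (j < p)%N -> flip i j p = p.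
Proof. by move=> h; rewrite /flip ifN //; lia. Qed.

Lemma flip_in i j p : (i <= p <= j)%N -> flip i j p = (i + j - p)%N.
Proof. by rewrite /flip => ->. Qed.

Section CactusPerm.
Variable n : nat.

Lemma gflip_subproof (g : cgen n) (m : 'I_n) : (flip (lo g) (hi g) m < n)%N.
Proof. by case: g => i j /= /andP[_ ?]; apply: flip_lt. Qed.

Definition gflip_fun (g : cgen n) (m : 'I_n) : 'I_n := Ordinal (gflip_subproof g m).

Lemma gflip_funK g : involutive (gflip_fun g).
Proof. by move=> m; apply: ord_inj; apply: flipK. Qed.

Definition gflip (g : cgen n) : 'S_n := perm (inv_inj (gflip_funK g)).

Lemma val_gflip g (m : 'I_n) : gflip g m = flip (lo g) (hi g) m :> nat.
Proof. by rewrite permE. Qed.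

Definition cactus_perm (x : cactus n) : 'S_n := \prod_(g <- rep x) gflip g.

Lemma cactus_perm_word w : cactus_perm (word w) = \prod_(g <- w) gflip g.
Proof.
apply: (rep_cls (f := fun w => \prod_(g <- w) gflip g)) => _ _ [a b l r h].
rewrite !big_cat; congr (_ * (_ * _)).
apply/permP => m; apply: ord_inj.
case: h => [g|g h gh|g h h' lgh hgh eh eh'];
  rewrite ?big_cons big_nil !(permM, mulg1, perm1) /= ?val_gflip ?flipK //.
- by rewrite /flip; do !case: ifP; lia.
- by rewrite eh eh' /flip; have := cgenP h; do !case: ifP; lia.
Qed.

Lemma cactus_permM : {morph cactus_perm : x y / x * y}.
Proof.
by elim/wordW=> u; elim/wordW=> v; rewrite -word_cat !cactus_perm_word big_cat.
Qed.

Lemma cactus_perm_sgen i j (m : 'I_n) : (j < n)%N ->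
  cactus_perm (sgen n i j) m = flip i j m :> nat.
Proof.
move=> jn; have [ij|ij] := ltnP i j.
  have [|g -> [gi gj]] := @sgen_ex n i j; first by lia.
  by rewrite cactus_perm_word big_seq1 val_gflip gi gj.
rewrite sgen0; last by lia.
rewrite -word_nil cactus_perm_word big_nil perm1 /flip; case: ifP; lia.
Qed.

End CactusPerm.

(* The factor replacing the generator s_(i, j) in the expansion at a strand that
   is in position [p] just before this generator. *)
Definition sclone N (i j p : nat) : cactus N :=
  if (j < p)%N then sgen N i j
  else if (i <= p)%N then sgen N p p.+1 * sgen N i j.+1
  else sgen N i.+1 j.+1.

Fixpoint wclone n (p : 'I_n) (w : seq (cgen n)) : cactus n.+1 :=
  if w is g :: w' then sclone n.+1 (lo g) (hi g) p * wclone (gflip g p) w'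
  else 1.

Definition cactus_clone n (p : 'I_n) (x : cactus n) : cactus n.+1 :=
  wclone p (rep x).

Lemma wclone_cat n (p : 'I_n) u v :
  wclone p (u ++ v) = wclone p u * wclone ((\prod_(g <- u) gflip g) p) v.
Proof.
elim: u p => [|g u IH] p /=; first by rewrite big_nil perm1 mul1g.
by rewrite IH big_cons permM mulgA.
Qed.

Lemma sclone_lt N i j p : (j < p)%N -> sclone N i j p = sgen N i j.
Proof. by rewrite /sclone => ->. Qed.

Lemma sclone_gt N i j p : (i < j)%N -> (p < i)%N ->
  sclone N i j p = sgen N i.+1 j.+1.
Proof. by move=> ij pi; rewrite /sclone !ifN //; lia. Qed.

Lemma sclone_in N i j p : (i <= p <= j)%N ->
  sclone N i j p = sgen N p p.+1 * sgen N i j.+1.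
Proof. by move=> h; rewrite /sclone ifN ?ifT //; lia. Qed.

Section CloneRelations.
Variable N : nat.
Local Notation s := (sgen N).

Lemma sgenKl i j x : s i j * (s i j * x) = x.
Proof. by rewrite mulgA sgenK mul1g. Qed.

Lemma sclone_invol i j p : (i < j)%N -> (j.+1 < N)%N ->
  sclone N i j p * sclone N i j (flip i j p) = 1.
Proof.
move=> ij jN; have [h|h] := ltnP j p.
  by rewrite flip_hi // sclone_lt // sgenK.
have [h'|h'] := ltnP p i; first by rewrite flip_lo // sclone_gt // sgenK.
rewrite flip_in ?h' // !sclone_in; [|lia..].
rewrite -mulgA (mulgA (s i j.+1)) sgenN; [|lia..].
have -> : (i + j.+1 - (i + j - p).+1 = p)%N by lia.
have -> : (i + j.+1 - (i + j - p) = p.+1)%N by lia.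
by rewrite -mulgA sgenK mulg1 sgenK.
Qed.

Lemma sclone_disjoint i j k l p : (i < j)%N -> (j < k)%N -> (k < l)%N ->
  (l.+1 < N)%N ->
  sclone N i j p * sclone N k l (flip i j p)
  = sclone N k l p * sclone N i j (flip k l p).
Proof.
move=> ij jk kl lN.
have [h1|h1] := ltnP p i.
  rewrite !flip_lo; [|lia..]; rewrite !sclone_gt; [|lia..].
  by apply: sgenC; lia.
have [h2|h2] := leqP p j.
  rewrite flip_in ?h1 // (flip_lo _ (_ : p < k)%N); last by lia.
  rewrite (@sclone_in _ i) ?h1 // !(@sclone_gt _ k); [|lia..].
  rewrite -mulgA (@sgenC _ i j.+1) ?mulgA; last by lia.
  by rewrite (@sgenC _ p p.+1) //; lia.
rewrite flip_hi //; have [h3|h3] := ltnP p k.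
  rewrite flip_lo // !(@sclone_lt _ i) // sclone_gt //.
  by apply: sgenC; lia.
have [h4|h4] := leqP p l.
  rewrite flip_in ?h3 // !(@sclone_lt _ i); [|lia..].
  rewrite sclone_in ?h3 // mulgA (@sgenC _ i j) -?mulgA; last by lia.
  by rewrite (@sgenC _ i j) //; lia.
rewrite flip_hi // !sclone_lt; [|lia..].
exact: sgenC.
Qed.

Lemma sclone_nested i j k l i' j' p : (i <= k)%N -> (k < l)%N -> (l <= j)%N ->
  (j.+1 < N)%N -> i' = (i + j - l)%N -> j' = (i + j - k)%N ->
  sclone N i j p * sclone N k l (flip i j p)
  = sclone N i' j' p * sclone N i j (flip i' j' p).
Proof.
move=> ik kl lj jN ei ej.
have [h1|h1] := ltnP p i.
  rewrite !flip_lo; [|lia..]; rewrite !sclone_gt; [|lia..].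
  rewrite sgenN; [|lia..].
  by congr (s _ _ * _); lia.
have [h2|h2] := ltnP j p.
  rewrite !flip_hi; [|lia..]; rewrite !sclone_lt; [|lia..].
  by rewrite sgenN -?ei -?ej //; lia.
rewrite flip_in ?h1 // (@sclone_in _ i j) ?h1 //.
have [h3|h3] := ltnP p i'.
  rewrite flip_lo // (@sclone_in _ i j) ?h1 //.
  rewrite (@sclone_lt _ k); last by lia.
  rewrite sclone_gt; [|lia..].
  rewrite -mulgA (@sgenN _ i j.+1 k l); [|lia..].
  have -> : (i + j.+1 - l = i'.+1)%N by lia.
  have -> : (i + j.+1 - k = j'.+1)%N by lia.
  by rewrite !mulgA (@sgenC _ p p.+1).
have [h4|h4] := ltnP j' p.
  rewrite flip_hi // (@sclone_in _ i j) ?h1 //.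
  rewrite (@sclone_gt _ k); [|lia..].
  rewrite sclone_lt //.
  rewrite -mulgA (@sgenN _ i j.+1 k.+1 l.+1); [|lia..].
  have -> : (i + j.+1 - l.+1 = i')%N by lia.
  have -> : (i + j.+1 - k.+1 = j')%N by lia.
  by rewrite !mulgA (@sgenC _ i' j' p).
rewrite flip_in ?h3 // !sclone_in; [|lia..].
rewrite -!mulgA (mulgA (s i j.+1)) (@sgenN _ i j.+1 (_ - _)); [|lia..].
have -> : (i + j.+1 - (i + j - p).+1 = p)%N by lia.
have -> : (i + j.+1 - (i + j - p) = p.+1)%N by lia.
rewrite -!mulgA sgenKl (@sgenN _ i j.+1 k l.+1); [|lia..].
have -> : (i + j.+1 - l.+1 = i')%N by lia.
have -> : (i + j.+1 - k = j'.+1)%N by lia.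
rewrite (mulgA (s i' j'.+1)) (@sgenN _ i' j'.+1 (i' + j' - p)%N); [|lia..].
have -> : (i' + j'.+1 - (i' + j' - p).+1 = p)%N by lia.
have -> : (i' + j'.+1 - (i' + j' - p) = p.+1)%N by lia.
by rewrite -!mulgA sgenKl.
Qed.

End CloneRelations.

Section CactusClone.
Variable n : nat.
Implicit Types (p : 'I_n) (w : seq (cgen n)).

Lemma cactus_clone_word p w : cactus_clone p (word w) = wclone p w.
Proof.
apply: (rep_cls (f := wclone p)) => _ _ [a b l r h].
have eP : \prod_(g <- l) gflip g = \prod_(g <- r) gflip g.
  rewrite -!cactus_perm_word; congr cactus_perm.
  exact: (word_rel1 h).
rewrite !wclone_cat eP; congr (_ * (_ * _)).
move: (_ p) => {}p; case: h {eP} => [g|g h gh|g h h' lgh hgh eh eh'] /=;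
  rewrite !mulg1 !val_gflip.
- by have := cgenP g => /andP[? ?]; apply: sclone_invol.
- have := cgenP g; have := cgenP h => /andP[? ?] /andP[? ?].
  by apply: sclone_disjoint.
- have := cgenP g; have := cgenP h => /andP[? ?] /andP[? ?].
  by apply: sclone_nested.
Qed.

Lemma cactus_cloneM p (x y : cactus n) :
  cactus_clone p (x * y)
  = cactus_clone p x * cactus_clone (cactus_perm x p) y.
Proof.
elim/wordW: x => u; elim/wordW: y => v.
by rewrite -word_cat !cactus_clone_word cactus_perm_word wclone_cat.
Qed.

Lemma cactus_clone_sgen p i j : (i < j < n)%N ->
  cactus_clone p (sgen n i j) = sclone n.+1 i j p.
Proof.
by case/sgen_ex=> g -> [<- <-]; rewrite cactus_clone_word /= mulg1.
Qed.

Lemma cactus_perm_sclone p (g : cgen n) :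
  cactus_perm (sclone n.+1 (lo g) (hi g) p) = perm_clone p (gflip g).
Proof.
have := cgenP g; set i := lo g; set j := hi g => /andP[ij jn].
have pn := ltn_ord p.
have val_x x : cactus_perm (sclone n.+1 i j p) x =
  (if (j < p)%N then flip i j x else
   if (i <= p)%N then flip i j.+1 (flip p p.+1 x) else flip i.+1 j.+1 x) :> nat.
  rewrite /sclone; case: ifP => h1; first by rewrite cactus_perm_sgen //; lia.
  case: ifP => h2; last by rewrite cactus_perm_sgen //; lia.
  by rewrite cactus_permM permM !cactus_perm_sgen.
apply/permP; apply: (@leaf_cases _ p) => [|k]; apply: ord_inj; rewrite val_x.
  rewrite perm_clone_rchild !val_rchild val_gflip -/i -/j.
  have := flip_spec i j p; have := flip_spec i j p.+1.
  have := flip_spec i.+1 j.+1 p.+1; have := flip_spec p p.+1 p.+1.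
  have := flip_spec i j.+1 (flip p p.+1 p.+1).
  by case: (ltnP j p) => ?; [|case: (leqP i p) => ?]; lia.
rewrite perm_clone_newpos !val_newpos !val_gflip -/i -/j.
have := bump_spec p.+1 k; have := bump_spec (flip i j p).+1 (flip i j k).
move: (bump p.+1 k) (bump _ _) => b c.
have := flip_spec i j k; move: (flip i j k) => f.
have [jp|pj] := ltnP j p.
  rewrite flip_hi //; have := flip_spec i j b; lia.
have [ip|pi] := leqP i p.
  rewrite flip_in ?ip //; have := flip_spec p p.+1 b.
  move: (flip p p.+1 b) => d; have := flip_spec i j.+1 d.
  move: (flip _ _ _) => e; lia.
rewrite (flip_lo _ pi); have := flip_spec i.+1 j.+1 b; lia.
Qed.

Lemma cactus_perm_clone p (x : cactus n) :
  cactus_perm (cactus_clone p x) = perm_clone p (cactus_perm x).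
Proof.
elim/wordW: x => w; rewrite cactus_clone_word cactus_perm_word.
elim: w p => [|g w IH] p /=.
  by rewrite -word_nil cactus_perm_word !big_nil /perm_clone perm1 lift_perm1.
by rewrite big_cons perm_cloneM cactus_permM IH cactus_perm_sclone.
Qed.

End CactusClone.

Lemma sclone_C n (p r : 'I_n) (g : cgen n) : (p < r)%N ->
  cactus_clone (newpos p r) (sclone n.+1 (lo g) (hi g) p)
  = cactus_clone (newpos r p) (sclone n.+1 (lo g) (hi g) r).
Proof.
have := cgenP g; move: (lo g) (hi g) => i j /andP[ij jn] pr.
have vr : newpos p r = r.+1 :> nat by rewrite val_newpos bumpS_gt.
have vp : newpos r p = p :> nat by rewrite val_newpos bumpS_lt.
have rn := ltn_ord r.
have [h1|h1] := ltnP j p.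
  by rewrite !sclone_lt ?cactus_clone_sgen ?sclone_lt ?vr ?vp //; lia.
have [h2|h2] := ltnP p i; have [h3|h3] := ltnP r i.
- by rewrite !sclone_gt ?cactus_clone_sgen ?sclone_gt ?vr ?vp //; lia.
- have [h4|h4] := ltnP j r.
    rewrite sclone_gt // sclone_lt // !cactus_clone_sgen; [|lia..].
    by rewrite sclone_lt ?sclone_gt ?vr ?vp //; lia.
  rewrite sclone_gt // sclone_in ?h3 // cactus_cloneM.
  rewrite !cactus_clone_sgen; [|lia..].
  rewrite cactus_perm_sgen ?vr ?vp; last by lia.
  rewrite sclone_in; last by lia.
  rewrite !sclone_gt ?flip_lo //; lia.
- lia.
have [h4|h4] := ltnP j r.
  rewrite sclone_in ?h2 // sclone_lt // cactus_cloneM.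
  rewrite !cactus_clone_sgen; [|lia..].
  rewrite cactus_perm_sgen ?vr ?vp; last by lia.
  rewrite flip_hi; last by lia.
  by rewrite !(@sclone_lt _ _ _ r.+1) ?sclone_in ?h2 //; lia.
rewrite !sclone_in; [|lia..]; rewrite !cactus_cloneM !cactus_clone_sgen; [|lia..].
rewrite !cactus_perm_sgen ?vr ?vp; [|lia..].
rewrite flip_hi ?flip_lo; [|lia..].
rewrite sclone_lt ?(@sclone_gt _ r); [|lia..].
rewrite !sclone_in; [|lia..].
by rewrite !mulgA sgenC.
Qed.

Lemma cactus_cloneC n (i j : 'I_n) (s : cactus n) : i <> j ->
  cactus_clone (newpos i j) (cactus_clone i s)
  = cactus_clone (newpos j i) (cactus_clone j s).
Proof.
elim/wordW: s => w ij; rewrite !cactus_clone_word.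
elim: w i j ij => [|g w IH] i j ij /=; first by rewrite -word_nil !cactus_clone_word.
rewrite !cactus_cloneM !cactus_perm_sclone !perm_clone_newpos IH; last first.
  by move/perm_inj.
congr (_ * _); case: (ltngtP i j) => [ij'|ji'|/ord_inj //].
- exact: sclone_C.
- exact/esym/sclone_C.
Qed.

Definition cactus_cloning : cloning :=
  Cloning (cgrp := fun n => cactus n) cactus_permM cactus_cloneM
    cactus_perm_clone cactus_cloneC.

Definition CV : groupType := thompson cactus_cloning.

Definition pibar_pair (X : tpair cactus_cloning) : tpair perm_cloning :=
  @TPair perm_cloning (tsize X) (tsrc X) (cactus_perm (tmid X)) (ttgt X).

Definition pibar (x : CV) : V := tcls (pibar_pair (rep x)).

Lemma pibarE X : pibar (tcls X) = tcls (pibar_pair X).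
Proof.
apply: (rep_cls (f := tcls \o pibar_pair)) => {}X _ [i ->] /=.
apply: cls_step; exists i; rewrite /expand /pibar_pair /=.
by rewrite cactus_perm_clone.
Qed.

Lemma pibarM : {morph pibar : x y / x * y}.
Proof.
move=> x y; have [n [A [M [B [s [t [-> -> e]]]]]]] := tmulP x y.
rewrite [_ * _]e !pibarE /pibar_pair /= cactus_permM.
exact/esym/(@tmulE perm_cloning).
Qed.

HB.instance Definition _ := isMultiplicative.Build CV V pibar pibarM.

Definition PCV (x : CV) : Prop := pibar x = 1.

(* s_(i, j) s_(i+1, j-1) maps to the transposition of i and j. *)
Lemma cactus_perm_tperm n (i j : 'I_n) : (i < j)%N ->
  cactus_perm (sgen n i j * sgen n i.+1 j.-1) = tperm i j.
Proof.
move=> ij; have jn := ltn_ord j; apply/permP => m; apply: ord_inj.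
rewrite cactus_permM permM !cactus_perm_sgen; [|lia..].
have := flip_spec i j m; have := flip_spec i.+1 j.-1 (flip i j m).
case: tpermP => [->|->|/eqP + /eqP]; [lia..|].
rewrite -!(inj_eq (@ord_inj _)); lia.
Qed.

Lemma cactus_perm_surj n (s : 'S_n) : exists x : cactus n, cactus_perm x = s.
Proof.
have [ts -> _] := prod_tpermP s; elim: ts => [|[i j] ts [x IH]].
  by exists 1; rewrite big_nil -word_nil cactus_perm_word big_nil.
have [y ey] : exists y : cactus n, cactus_perm y = tperm i j.
  case: (ltngtP i j) => [ij|ji|/ord_inj ->].
  - by exists (sgen n i j * sgen n i.+1 j.-1); exact: cactus_perm_tperm.
  - by exists (sgen n j i * sgen n j.+1 i.-1); rewrite tpermC; exact: cactus_perm_tperm.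
  - by exists 1; rewrite tperm1 -word_nil cactus_perm_word big_nil.
by exists (y * x); rewrite big_cons /= cactus_permM IH ey.
Qed.

Lemma pibar_surj (v : V) : exists x : CV, pibar x = v.
Proof.
elim/clsW: v => -[n A s B]; have [x xs] := cactus_perm_surj s.
exists (tcls (@TPair cactus_cloning n A x B)).
by rewrite pibarE /pibar_pair /= xs.
Qed.

(* Main.v *)
Require Import Defs.
From mathcomp Require Import all_boot all_fingroup.
From mathcomp Require Import order ssralg ssrnum ssrint intdiv zify.

(** A section [iota] would send an element [v] of order 3 of V to an element
    [x] of CV with [x ^ 3 = 1] lying above [v]; for a suitable [v] there is no
    such [x].  The reason is already visible in J_3, the infinite dihedral
    group: its elements above a 3-cycle are nontrivial translations, which have
    infinite order.

    To carry this over to every J_n, follow three distinct strands, labelled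
    0, 1, 2, and forget all others.  A generator then acts on the three strands
    as the identity, as a reversal of two neighbours, or as a reversal of all
    three.  In J_3, acting on the line by x |-> -1 - x, x |-> - x and
    x |-> 1 - x for the reversal of the left pair, of all three and of the
    right pair, a word has a translation part, in which these constants occur
    with signs that alternate along the nontrivial letters.  The sign is the
    orientation of the labels, whose cyclic rotations leave it unchanged.  This
    gives an integer [cactus_turn p q r x] with four properties:
    - it is additive along products, as the strands move
      ([cactus_turnM]);
    - it is invariant under rotation of the labels ([cactus_turn_rot]);
    - modulo 3 it is the change of the label of the strand in the middle
      ([cactus_turn_mod3]);
    - it does not change when a strand is doubled, if left children inherit the
      labels ([cactus_turn_clone]).

    Now let [v] rotate the three leaves of a tree [t].  For every expansion
    [(A, s, B)] of [(t, rot3, t)], the leftmost leaves of [A] below the leaves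
    of [t] go to the leftmost leaves of [B] below the leaves of [t], rotated by
    [rot3].  Following these strands in representatives of [x] gives, by
    invariance under doubling, an integer [d] that depends on [x] alone.  Since
    [v] only rotates the labels, [x ^ 3] has turn [d + d + d], which is 0 as
    [x ^ 3 = 1].  But [d] is 2 modulo 3, since a rotation changes the strand in
    the middle. *)

Set Implicit Arguments.
Unset Strict Implicit.
Unset Printing Implicit Defensive.
Import GRing.Theory.
Local Open Scope ring_scope.

(** * The turn of three positions under a reversal *)

Definition order_sign (p q : nat) : int :=
  if (p < q)%N then 1 else if (q < p)%N then - 1 else 0.

(** The contribution of the strands at [p] and [q] to [turn] below: nonzero
    only when the reversed interval contains these two strands but not the
    third one, at [r]. *)
Definition pair_turn (i j p q r : nat) : int :=
  if (i <= p <= j)%N && (i <= q <= j)%N then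
    if (r < i)%N then order_sign p q
    else if (j < r)%N then - order_sign p q else 0
  else 0.

Lemma order_signC p q : order_sign q p = - order_sign p q.
Proof. by rewrite /order_sign; case: ltngtP => _; rewrite ?opprK ?oppr0. Qed.

Lemma order_sign_mono p q p' q' :
  (p' < q')%N = (p < q)%N -> (q' < p')%N = (q < p)%N ->
  order_sign p' q' = order_sign p q.
Proof. by rewrite /order_sign => -> ->. Qed.

Lemma order_sign_flip i j p q :
  order_sign (flip i j p) (flip i j q) =
  if (i <= p <= j)%N && (i <= q <= j)%N then - order_sign p q
  else order_sign p q.
Proof.
have := flip_spec i j p; have := flip_spec i j q.
by case: ifP => h hq hp; rewrite -?order_signC; apply: order_sign_mono; lia.
Qed.

Lemma flip_within i j k l p : (i <= k)%N -> (l <= j)%N ->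
  (i <= flip k l p <= j)%N = (i <= p <= j)%N.
Proof. by have := flip_spec k l p; lia. Qed.

Lemma flip_within_mirror i j k l p : (i <= k)%N -> (l <= j)%N -> (k <= l)%N ->
  (k <= flip i j p <= l)%N = (i + j - l <= p <= i + j - k)%N.
Proof. by have := flip_spec i j p; lia. Qed.

Lemma flip_apart i j k l p : (i <= j)%N -> (k <= l)%N ->
  (j < k)%N || (l < i)%N ->
  (k <= flip i j p <= l)%N = (k <= p <= l)%N.
Proof. by have := flip_spec i j p; lia. Qed.

(** Moving the strands by a smaller reversal does not change which of them the
    larger interval contains, so that only the order of [p] and [q] matters. *)
Lemma pair_turn_after i j k l p q r : (i <= k)%N -> (l <= j)%N ->
  pair_turn i j (flip k l p) (flip k l q) (flip k l r) =
  if (k <= p <= l)%N && (k <= q <= l)%N then - pair_turn i j p q r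
  else pair_turn i j p q r.
Proof.
move=> ik lj; rewrite /pair_turn !flip_within //.
case: ifP => h; last by rewrite oppr0 if_same.
have -> : (flip k l r < i = (r < i))%N by have := flip_spec k l r; lia.
have -> : (j < flip k l r = (j < r))%N by have := flip_spec k l r; lia.
by rewrite order_sign_flip; do !case: ifP; rewrite ?oppr0.
Qed.

(** The mirror image in the interval from [i] to [j] exchanges left and right.
    If [r] lies in that interval, then both the order of [p] and [q] and the
    side of [r] are exchanged, and the signs cancel; otherwise only the order is
    exchanged, which costs twice the contribution of the larger interval. *)
Lemma pair_turn_before i j k l p q r : (i <= k)%N -> (k <= l)%N -> (l <= j)%N ->
  let i' := (i + j - l)%N in let j' := (i + j - k)%N in
  pair_turn k l (flip i j p) (flip i j q) (flip i j r) =
  pair_turn i' j' p q r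
    - if (i' <= p <= j')%N && (i' <= q <= j')%N then pair_turn i j p q r *+ 2
      else 0.
Proof.
move=> ik kl lj /=; rewrite /pair_turn !flip_within_mirror //.
case: ifP => // h; rewrite order_sign_flip.
have -> : (i <= p <= j)%N && (i <= q <= j)%N by lia.
move: (order_sign p q) => e; have := flip_spec i j r.
rewrite mulr2n; do !case: ifP; lia.
Qed.

Lemma pair_turn_apart i j k l p q r : (i <= j)%N -> (k <= l)%N ->
  (j < k)%N || (l < i)%N ->
  pair_turn k l (flip i j p) (flip i j q) (flip i j r) = pair_turn k l p q r.
Proof.
move=> ij jk kl; rewrite /pair_turn !flip_apart //.
case: ifP => // h; rewrite order_sign_flip.
have -> : (i <= p <= j)%N && (i <= q <= j)%N = false by lia.
have -> : (flip i j r < k = (r < k))%N by have := flip_spec i j r; lia.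
by have -> : (l < flip i j r = (l < r))%N by have := flip_spec i j r; lia.
Qed.

(** The signed constant of the reversal of [i, ..., j], seen on three labelled
    strands: if the interval contains exactly two of them, then it is, up to
    the orientation of the labels, -1 for the left pair and 1 for the right
    pair. *)
Definition turn (i j p q r : nat) : int :=
  pair_turn i j p q r + pair_turn i j q r p + pair_turn i j r p q.

(** The label, 0 for [p], 1 for [q] and 2 for [r], of the position between the
    other two. *)
Definition middle (p q r : nat) : int :=
  if (q < p < r)%N || (r < p < q)%N then 0
  else if (p < q < r)%N || (r < q < p)%N then 1 else 2.

Lemma pair_turnC i j p q r : pair_turn i j q p r = - pair_turn i j p q r.
Proof.
by rewrite /pair_turn andbC order_signC; do !case: ifP; rewrite ?oppr0.
Qed.

Lemma turn_rot i j p q r : turn i j q r p = turn i j p q r.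
Proof. by rewrite /turn addrC addrA. Qed.

Lemma turn_rev i j p q r : turn i j r q p = - turn i j p q r.
Proof.
rewrite /turn (pair_turnC i j q r) (pair_turnC i j p q) (pair_turnC i j r p).
by rewrite !opprD (addrC (- pair_turn i j q r p)).
Qed.

Lemma middle_bound p q r : 0 <= middle p q r < 3.
Proof. by rewrite /middle; do !case: ifP. Qed.

Lemma middle_rot p q r : p <> q -> q <> r -> r <> p ->
  (middle q r p = middle p q r + 2 %[mod 3])%Z.
Proof.
rewrite /middle.
by case: (ltngtP p q); case: (ltngtP q r); case: (ltngtP r p); try lia;
  move=> *; rewrite ?andbF.
Qed.

Lemma middle_rev p q r : p <> q -> q <> r -> r <> p ->
  middle r q p = 2 - middle p q r.
Proof.
rewrite /middle.
by case: (ltngtP p q); case: (ltngtP q r); case: (ltngtP r p); try lia;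
  move=> *; rewrite ?andbF.
Qed.

Lemma turn_sorted i j p q r : (p < q < r)%N -> (i < j)%N ->
  turn i j p q r + 1 = middle (flip i j p) (flip i j q) (flip i j r).
Proof.
move=> /andP[pq qr] ij.
have pr := ltn_trans pq qr.
have := flip_spec i j p; have := flip_spec i j q; have := flip_spec i j r.
move: (flip i j p) (flip i j q) (flip i j r) => p' q' r' hr hq hp.
rewrite /turn /pair_turn.
rewrite (order_signC p r) /order_sign pq qr pr.
case: (boolP (i <= p <= j)%N) hp => ?; case: (boolP (i <= q <= j)%N) hq => ?;
  case: (boolP (i <= r <= j)%N) hr => ? ??? /=; rewrite /middle;
  do ?case: ifP => ?; lia.
Qed.

(** Rotating the labels shifts [middle] by a constant modulo 3, and exchanging
    the labels 0 and 2 changes the sign of [turn] and replaces [middle] by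
    [2 - middle]; so it is enough to consider [p < q < r]. *)
Lemma turn_mod3 i j p q r : p <> q -> q <> r -> r <> p -> (i < j)%N ->
  (turn i j p q r + middle p q r =
    middle (flip i j p) (flip i j q) (flip i j r) %[mod 3])%Z.
Proof.
move=> pq qr rp ij.
have fI u v : u <> v -> flip i j u <> flip i j v.
  by move=> uv /(inv_inj (flipK i j)).
have mid1 u v w : u <> v -> v <> w -> w <> u -> middle u v w = 1 ->
    turn i j u v w + 1 = middle (flip i j u) (flip i j v) (flip i j w).
  move=> uv vw wu; rewrite {1}/middle.
  case: ifP => // _; case: ifP => // /orP[] uvw _; first exact: turn_sorted.
  rewrite middle_rev; [|exact/fI/nesym..].
  by rewrite -turn_sorted // turn_rev; lia.
have e1 := middle_rot pq qr rp; have e2 := middle_rot qr rp pq.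
have e3 := middle_rot (fI _ _ pq) (fI _ _ qr) (fI _ _ rp).
have e4 := middle_rot (fI _ _ qr) (fI _ _ rp) (fI _ _ pq).
have [m|[m|m]] : middle p q r = 1 \/ middle q r p = 1 \/ middle r p q = 1.
- by have := middle_bound p q r; have := middle_bound q r p;
    have := middle_bound r p q; lia.
- by rewrite -(mid1 _ _ _ pq qr rp m) m.
- have := mid1 _ _ _ qr rp pq m; rewrite turn_rot; lia.
- have := mid1 _ _ _ rp pq qr m; rewrite 2!turn_rot; lia.
Qed.

(** * The relations of the cactus group *)

Lemma turn_invol i j p q r :
  turn i j p q r + turn i j (flip i j p) (flip i j q) (flip i j r) = 0.
Proof.
have h x y z :
    pair_turn i j (flip i j x) (flip i j y) (flip i j z)
    = - pair_turn i j x y z.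
  rewrite pair_turn_after //; case: ifP => // out.
  by rewrite /pair_turn out oppr0.
by rewrite /turn !h -!opprD subrr.
Qed.

Lemma turn_disjoint i j k l p q r : (i < j)%N -> (j < k)%N -> (k < l)%N ->
  turn i j p q r + turn k l (flip i j p) (flip i j q) (flip i j r) =
  turn k l p q r + turn i j (flip k l p) (flip k l q) (flip k l r).
Proof.
move=> /ltnW ij jk /ltnW kl.
by rewrite /turn !pair_turn_apart // ?jk ?orbT // [LHS]addrC.
Qed.

Lemma turn_nested i j k l i' j' p q r : (i <= k)%N -> (k < l)%N -> (l <= j)%N ->
  i' = (i + j - l)%N -> j' = (i + j - k)%N ->
  turn i j p q r + turn k l (flip i j p) (flip i j q) (flip i j r) =
  turn i' j' p q r + turn i j (flip i' j' p) (flip i' j' q) (flip i' j' r).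
Proof.
move=> ik kl lj -> ->; set i1 := (i + j - l)%N; set j1 := (i + j - k)%N.
have h x y z :
    pair_turn i j x y z + pair_turn k l (flip i j x) (flip i j y) (flip i j z) =
    pair_turn i1 j1 x y z
    + pair_turn i j (flip i1 j1 x) (flip i1 j1 y) (flip i1 j1 z).
  rewrite pair_turn_before ?(ltnW kl) // -/i1 -/j1.
  rewrite pair_turn_after; [|rewrite /i1 /j1; lia..].
  by case: ifP => _; rewrite ?mulr2n; lia.
rewrite /turn; have := h p q r; have := h q r p; have := h r p q; lia.
Qed.

(** [turn] sees only the order of the three positions and their place relative
    to the interval; [bump h] skips the new position [h]. *)
Lemma turn_bump h i j i' j' p q r :
  (forall x, (i' <= bump h x <= j') = (i <= x <= j))%N ->
  (forall x, (bump h x < i') = (x < i))%N ->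
  turn i' j' (bump h p) (bump h q) (bump h r) = turn i j p q r.
Proof.
move=> hin hlt.
have hp x y z :
    pair_turn i' j' (bump h x) (bump h y) (bump h z) = pair_turn i j x y z.
  rewrite /pair_turn !hin hlt; case: ifP => // xin.
  have -> : (j' < bump h z)%N = (j < z)%N.
    by move: (hin z) (hlt z); have := hlt x; have := hin x; lia.
  have -> // : order_sign (bump h x) (bump h y) = order_sign x y.
  by apply: order_sign_mono; have := bump_spec h x; have := bump_spec h y; lia.
by rewrite /turn !hp.
Qed.

(** The crossing of the two halves of a doubled strand is invisible, because
    the right half, at [m.+1], is not followed. *)
Lemma turn_near m p q r : m.+1 <> p -> m.+1 <> q -> m.+1 <> r ->
  turn m m.+1 p q r = 0.
Proof.
have h x y z : m.+1 <> x -> m.+1 <> y -> pair_turn m m.+1 x y z = 0.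
  move=> mx my; rewrite /pair_turn; case: ifP => // xy.
  have -> : y = x by lia.
  by rewrite /order_sign ltnn oppr0 !if_same.
by move=> mp mq mr; rewrite /turn !h.
Qed.

(** * The turn as a cocycle on the cactus group *)

Section CactusTurn.
Variable n : nat.

Fixpoint word_turn (p q r : 'I_n) (w : seq (cgen n)) : int :=
  if w is g :: w' then
    turn (lo g) (hi g) p q r + word_turn (gflip g p) (gflip g q) (gflip g r) w'
  else 0.

Definition cactus_turn (p q r : 'I_n) (x : cactus n) : int :=
  word_turn p q r (rep x).

Lemma word_turn_cat p q r u v : word_turn p q r (u ++ v) =
  word_turn p q r u
  + let s := (\prod_(g <- u) gflip g)%g in word_turn (s p) (s q) (s r) v.
Proof.
elim: u p q r => [|g u IH] p q r /=; first by rewrite big_nil !perm1 add0r.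
by rewrite IH big_cons !permM addrA.
Qed.

Lemma cactus_turn_word p q r w : cactus_turn p q r (word w) = word_turn p q r w.
Proof.
apply: (rep_cls (f := word_turn p q r)) => _ _ [a b l r' h].
have eP : (\prod_(g <- l) gflip g = \prod_(g <- r') gflip g)%g.
  by rewrite -!cactus_perm_word; congr cactus_perm; apply: word_rel1.
do 2!rewrite !word_turn_cat /=.
rewrite eP; congr (_ + (_ + _)).
move: (_ p) (_ q) (_ r) => {}p {}q {}r.
case: h {eP} => [g|g h gh|g h h' lgh hgh eh eh'] /=;
  rewrite !addr0 !val_gflip.
- exact: turn_invol.
- have := cgenP g; have := cgenP h => /andP[? ?] /andP[? ?].
  exact: turn_disjoint.
- have := cgenP g; have := cgenP h => /andP[? ?] /andP[? ?].
  exact: turn_nested.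
Qed.

Lemma cactus_turnM p q r x y : cactus_turn p q r (x * y)%g =
  cactus_turn p q r x +
  cactus_turn (cactus_perm x p) (cactus_perm x q) (cactus_perm x r) y.
Proof.
elim/wordW: x => u; elim/wordW: y => v.
by rewrite -word_cat !cactus_turn_word cactus_perm_word word_turn_cat.
Qed.

Lemma cactus_turn1 p q r : cactus_turn p q r 1%g = 0.
Proof. by rewrite -word_nil cactus_turn_word. Qed.

Lemma cactus_turn_rot p q r x : cactus_turn q r p x = cactus_turn p q r x.
Proof.
elim/wordW: x => w; rewrite !cactus_turn_word.
by elim: w p q r => //= g w IH p q r; rewrite IH turn_rot.
Qed.

Lemma cactus_turn_sgen i j p q r : (i < j < n)%N ->
  cactus_turn p q r (sgen n i j) = turn i j p q r.
Proof. by case/sgen_ex=> g -> [<- <-]; rewrite cactus_turn_word /= addr0. Qed.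

(** The turn is an integral lift of a quantity modulo 3 which depends only on
    the permutation; this forces it to be nonzero on 3-cycles. *)
Lemma cactus_turn_mod3 p q r x : p <> q -> q <> r -> r <> p ->
  (cactus_turn p q r x + middle p q r =
   middle (cactus_perm x p) (cactus_perm x q) (cactus_perm x r) %[mod 3])%Z.
Proof.
elim/wordW: x => w; rewrite !cactus_turn_word cactus_perm_word.
elim: w p q r => [|g w IH] p q r pq qr rp /=.
  by rewrite big_nil !perm1 add0r.
have gI u v : u <> v -> gflip g u <> gflip g v by move=> uv /perm_inj.
rewrite big_cons !permM -IH; [|exact: gI..].
have /andP[lh _] := cgenP g.
have vI (u v : 'I_n) : u <> v -> (u : nat) <> v by move=> uv /ord_inj.
have := turn_mod3 (vI _ _ pq) (vI _ _ qr) (vI _ _ rp) lh.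
rewrite !val_gflip; lia.
Qed.

End CactusTurn.

(** * Invariance under doubling of strands *)

Lemma cactus_turn_sclone n (m p q r : 'I_n) (g : cgen n) :
  cactus_turn (newpos m p) (newpos m q) (newpos m r)
    (sclone n.+1 (lo g) (hi g) m) =
  turn (lo g) (hi g) p q r.
Proof.
have := cgenP g; move: (lo g) (hi g) => i j /andP[ij jn].
have [jm|mj] := ltnP j m.
  rewrite sclone_lt // cactus_turn_sgen; last by lia.
  by rewrite !val_newpos; apply: turn_bump => x; have := bump_spec m.+1 x; lia.
have [im|mi] := leqP i m; last first.
  rewrite sclone_gt // cactus_turn_sgen; last by lia.
  by rewrite !val_newpos; apply: turn_bump => x; have := bump_spec m.+1 x; lia.
rewrite sclone_in ?im // cactus_turnM !cactus_turn_sgen; [|lia..].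
rewrite turn_near; [|by apply/eqP; rewrite val_newpos neq_bump..].
rewrite add0r !cactus_perm_sgen ?val_newpos; [|lia..].
(* After the crossing, the followed half is the right one, so that the position
   [m] is now the new one. *)
have fb x : flip m m.+1 (bump m.+1 x) = bump m x.
  by have := flip_spec m m.+1 (bump m.+1 x); have := bump_spec m x;
     have := bump_spec m.+1 x; lia.
by rewrite !fb; apply: turn_bump => x; have := bump_spec m x; lia.
Qed.

Lemma cactus_turn_clone n (m p q r : 'I_n) (x : cactus n) :
  cactus_turn (newpos m p) (newpos m q) (newpos m r) (cactus_clone m x) =
  cactus_turn p q r x.
Proof.
elim/wordW: x => w; rewrite cactus_clone_word cactus_turn_word.
elim: w m p q r => [|g w IH] m p q r /=; first exact: cactus_turn1.
rewrite cactus_turnM cactus_turn_sclone cactus_perm_sclone.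
by rewrite !perm_clone_newpos IH.
Qed.

(** * Leftmost leaves below the leaves of a subtree *)

(** The number of the leftmost leaf of [a] below leaf [k] of [t], meant for
    [tle t a] and [k < leaves t]; other arguments give junk. *)
Fixpoint first_leaf (t a : btree) (k : nat) : nat :=
  match t, a with
  | Node t1 t2, Node a1 a2 =>
      if (k < leaves t1)%N then first_leaf t1 a1 k
      else (leaves a1 + first_leaf t2 a2 (k - leaves t1))%N
  | _, _ => 0%N
  end.

Lemma first_leaf_lt t a k : (first_leaf t a k < leaves a)%N.
Proof.
elim: t a k => [|t1 IH1 t2 IH2] [|a1 a2] k //=.
  by have := leaves_gt0 a1; lia.
by case: ifP => _; [have := IH1 a1 k|have := IH2 a2 (k - leaves t1)%N]; lia.
Qed.

Lemma first_leaf_mono t a k l : tle t a -> (k < l < leaves t)%N ->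
  (first_leaf t a k < first_leaf t a l)%N.
Proof.
elim: t a k l => [|t1 IH1 t2 IH2] [|a1 a2] k l //=; [lia|lia|].
move=> /andP[le1 le2] kl; do 2!case: ifP => ?; try lia.
- by apply: IH1 => //; lia.
- by have := first_leaf_lt t1 a1 k; lia.
- by rewrite ltn_add2l; apply: IH2 => //; lia.
Qed.

Lemma first_leaf_refl t k : (k < leaves t)%N -> first_leaf t t k = k.
Proof.
elim: t k => [|t1 IH1 t2 IH2] k /=; first by lia.
by case: ifP => ? ?; rewrite ?IH1 ?IH2 //; lia.
Qed.

(** An attached caret turns the leaf [i] into its left child, so that leftmost
    leaves are renumbered by [newpos i] and never become right children. *)
Lemma first_leaf_attach t a i k : tle t a -> (i < leaves a)%N ->
  first_leaf t (battach a i) k = bump i.+1 (first_leaf t a k).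
Proof.
elim: t a i k => [|t1 IH1 t2 IH2] [|a1 a2] i k //=.
move=> /andP[le1 le2] ia; case: ifP => [i1|i1] /=; case: ifP => k1.
- exact: IH1.
- rewrite leaves_battach bumpE ifT ?addSn //; lia.
- by have := first_leaf_lt t1 a1 k; rewrite bumpE; case: ifP; lia.
- rewrite IH2 //; last by lia.
  rewrite !bumpE; do 2!case: ifP; lia.
Qed.

(** * Tree pairs that permute the leaves of a fixed tree *)

Section Tracking.
Variables (m : nat) (t : tree m).

Lemma first_ord_subproof n (a : tree n) k :
  (first_leaf (sval t) (sval a) k < n)%N.
Proof. by rewrite -{2}(svalP a) first_leaf_lt. Qed.

Definition first_ord n (a : tree n) (k : nat) : 'I_n :=
  Ordinal (first_ord_subproof a k).

Lemma first_ord_attach n (a : tree n) i k : tle (sval t) (sval a) ->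
  first_ord (attach a i) k = newpos i (first_ord a k).
Proof.
move=> ta; apply: ord_inj.
by rewrite val_newpos /= first_leaf_attach // (svalP a).
Qed.

Lemma first_ord_mono n (a : tree n) k l : tle (sval t) (sval a) ->
  (k < l < m)%N -> (first_ord a k < first_ord a l)%N.
Proof. by move=> ta; rewrite -{1}(svalP t); apply: first_leaf_mono. Qed.

Lemma first_ord_neq n (a : tree n) k l : tle (sval t) (sval a) ->
  (k < m)%N -> (l < m)%N -> k <> l -> first_ord a k <> first_ord a l.
Proof.
move=> ta km lm kl e.
have := @first_ord_mono _ _ k l ta; have := @first_ord_mono _ _ l k ta.
by rewrite e; lia.
Qed.

(** A form of the statement that [X] acts as [(t, s, t)] which survives
    expansion: near its left end, the interval below leaf [k] of [t] goes to
    that below leaf [s k]. *)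
Definition tracks (C : cloning) (s : 'S_m) (X : tpair C) : Prop :=
  [/\ tle (sval t) (sval (tsrc X)), tle (sval t) (sval (ttgt X)) &
      forall k : 'I_m,
        cperm (tmid X) (first_ord (tsrc X) k) = first_ord (ttgt X) (s k)].

Lemma tracks_expands (C : cloning) s (X Y : tpair C) :
  expands X Y -> tracks s X -> tracks s Y.
Proof.
elim=> // {X Y} X Y Z [i ->] _ IH [tA tB h]; apply: IH; split=> [||k] /=.
- exact: tle_trans tA (tle_attach _ _).
- exact: tle_trans tB (tle_attach _ _).
- by rewrite cperm_clone !first_ord_attach // perm_clone_newpos h.
Qed.

Lemma tracks_self (s : 'S_m) : tracks s (@TPair perm_cloning m t s t).
Proof.
have e (k : 'I_m) : first_ord t k = k.
  by apply: ord_inj; rewrite /= first_leaf_refl // (svalP t).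
by split=> [||k] /=; rewrite ?tle_refl // !e.
Qed.

Lemma tracks_mul (C : cloning) n (A M B : tree n) (x y : C n) s s' :
  tracks s (TPair A x M) -> tracks s' (TPair M y B) ->
  tracks (s * s')%g (TPair A (x * y)%g B).
Proof.
move=> [tA _ h] [_ tB h']; split=> //= k.
by rewrite cpermM !permM -h' -h.
Qed.

End Tracking.

(** * The turn of an element of CV above a rotation *)

Lemma expands_lift (X : tpair cactus_cloning) Z : expands (pibar_pair X) Z ->
  exists2 Y, expands X Y & pibar_pair Y = Z.
Proof.
move: {-1}(pibar_pair X) (erefl (pibar_pair X)) => P eP h.
elim: h X eP => {P Z} [P|P Q Z [i ->] _ IH] X eP.
  by exists X => //; apply: expands_refl.
subst P; have [|Y XY <-] := IH (expand X i).
  by rewrite /expand /pibar_pair /= cactus_perm_clone.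
by exists Y => //; apply: expands_trans XY; apply: expands_step.
Qed.

Section TrackedTurn.
Variable t : tree 3.

Definition tracked_turn (X : tpair cactus_cloning) : int :=
  cactus_turn (first_ord t (tsrc X) 0) (first_ord t (tsrc X) 1)
    (first_ord t (tsrc X) 2) (tmid X).

Lemma tracked_turn_expands s X Y : expands X Y -> tracks t s X ->
  tracked_turn Y = tracked_turn X.
Proof.
elim=> // {X Y} X Y Z [i ->] _ IH hX; rewrite IH; last first.
  by apply: tracks_expands hX; apply: expands_step.
have [tA _ _] := hX; rewrite /tracked_turn /= !first_ord_attach //.
exact: cactus_turn_clone.
Qed.

(** A relation, and not a function of [x]: the turn is read off from any
    representative that follows the leaves of [t], and not every class has
    one. *)
Definition turns (x : CV) (s : 'S_3) (d : int) : Prop :=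
  exists X, [/\ tcls X = x, tracks t s X & tracked_turn X = d].

Definition rot3 : 'S_3 := perm (@ordS_inj 3).

Lemma tracks_rot3 (C : cloning) (X : tpair C) k :
  tracks t rot3 X -> (k < 3)%N ->
  cperm (tmid X) (first_ord t (tsrc X) k) = first_ord t (ttgt X) (k.+1 %% 3).
Proof. by case=> _ _ h k3; rewrite (h (Ordinal k3)) permE. Qed.

(** The second factor sees the three strands with rotated labels, and rotation
    does not change the turn; this is why the first factor is restricted to
    [rot3]. *)
Lemma turnsM x y s c d : turns x rot3 c -> turns y s d ->
  turns (x * y)%g (rot3 * s)%g (c + d).
Proof.
move=> [X [<- hX <-]] [Y [<- hY <-]].
have [X' XX' eX] := expands_tgt (tle_joinl (sval (ttgt X)) (sval (tsrc Y))).
have [Y' YY' eY] := expands_src (tle_joinr (sval (ttgt X)) (sval (tsrc Y))).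
rewrite -(tracked_turn_expands XX' hX) -(tracked_turn_expands YY' hY).
rewrite (expands_cls XX') (expands_cls YY').
move: {hX hY} (tracks_expands XX' hX) (tracks_expands YY' hY).
have [|n [A [M [B [u [v [-> ->]]]]]]] := @tpair_match _ X' Y'.
  by rewrite eX.
move=> hX hY; exists (@TPair cactus_cloning n A (u * v)%g B); split.
- exact/esym/tmulE.
- exact: tracks_mul hX hY.
- rewrite /tracked_turn /= cactus_turnM.
  have r k : (k < 3)%N ->
      cactus_perm u (first_ord t A k) = first_ord t M (k.+1 %% 3).
    exact: (tracks_rot3 hX).
  by rewrite !r // (cactus_turn_rot (first_ord t M 0)).
Qed.

(** A common expansion of any representative of 1 with the trivial pair has
    middle entry 1. *)
Lemma turns1 s d : turns 1%g s d -> d = 0.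
Proof.
move=> [X [e hX <-]].
have [Y XY oneY] := tcls_eq
  (e : tcls X = tcls (@TPair cactus_cloning 1 tleaf 1%g tleaf)).
rewrite -(tracked_turn_expands XY hX) /tracked_turn.
suff -> : tmid Y = 1%g by apply: cactus_turn1.
move: oneY {XY}; set O := TPair _ _ _ => OY.
have : tmid O = 1%g by [].
elim: OY => // U W Z [i ->] _ IH u1; apply: IH; rewrite /= u1.
exact: (@cclone1 cactus_cloning).
Qed.

(** The strand in the middle has label 1 before and label 0 after the
    rotation. *)
Lemma turns_rot3 x d : turns x rot3 d -> (d = 2 %[mod 3])%Z.
Proof.
move=> [X [_ hX <-]]; have [tA tB _] := hX.
have mono n (a : tree n) k l := @first_ord_mono _ t _ a k l.
pose p := first_ord t (tsrc X).
have [n01 n12 n20] : [/\ p 0%N <> p 1%N, p 1%N <> p 2%N & p 2%N <> p 0%N].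
  by split; apply: first_ord_neq.
have := cactus_turn_mod3 (tmid X) n01 n12 n20; rewrite /p => {p n01 n12 n20}.
have r k : (k < 3)%N -> cactus_perm (tmid X) (first_ord t (tsrc X) k) =
    first_ord t (ttgt X) (k.+1 %% 3).
  exact: (tracks_rot3 hX).
rewrite !r // -[(1 %% 3)%N]/1%N -[(2 %% 3)%N]/2%N -[(3 %% 3)%N]/0%N.
rewrite -/(tracked_turn X) /middle.
have := mono _ _ 0%N 1%N tA isT; have := mono _ _ 1%N 2%N tA isT.
have := mono _ _ 0%N 1%N tB isT; have := mono _ _ 1%N 2%N tB isT.
move: (tracked_turn X) => {}d /=.
do !case: ifP; lia.
Qed.

Lemma turns_ex x s : pibar x = tcls (@TPair perm_cloning 3 t s t) ->
  exists d, turns x s d.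
Proof.
elim/clsW: x => X; rewrite -[cls _ X]/(tcls X) pibarE => e.
have [Z XZ sZ] := tcls_eq e.
have [Y XY eZ] := expands_lift XZ.
exists (tracked_turn Y), Y; split=> //; first by rewrite (expands_cls XY).
by have := tracks_expands sZ (tracks_self t s); rewrite -eZ.
Qed.

End TrackedTurn.

Definition comb3 : tree 3 := exist _ (Node Leaf (Node Leaf Leaf)) erefl.

Theorem corollary3p7 :
  ~ exists iota : {multiplicative V -> CV}, forall v : V, pibar (iota v) = v.
Proof.
move=> [iota sec].
pose v : V := tcls (@TPair perm_cloning 3 comb3 rot3 comb3).
have v3 : (v * (v * v) = 1)%g.
  have r3 : (rot3 * (rot3 * rot3) = 1)%g.
    apply/permP => k; apply: ord_inj; rewrite !permM !permE.
    by case: k => [[|[|[|k]]] hk].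
  by rewrite -[LHS]/(tmul v (tmul v v)) !tmulE r3; exact: toneE.
have iota1 : iota 1%g = 1%g.
  by apply: (mulgI (iota 1%g)); rewrite -gmulfM !mulg1.
have [d hd] := turns_ex (sec v).
have := turnsM hd (turnsM hd hd).
rewrite -!gmulfM v3 iota1 => /turns1; have := turns_rot3 hd; lia.
Qed.
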